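(* For every tree $T$ of order $n$ that is not a path, we have the inequality $\operatorname{av}(T) \leq an + b$, where $a=\frac{5-\sqrt5}{10}$ and $b = (7\sqrt{5}-17)/10 \approx -0.13475241$. Consequently, the path $P_n$ maximizes the value of $\operatorname{av}(T)$ among all trees of order $n$.
   Context: A matching of a graph is a set of pairwise vertex-disjoint edges; $m(G,k)$ denotes the number of matchings of cardinality $k$ in $G$, and $\operatorname{av}(G)=\frac{\sum_{k\ge0}k\,m(G,k)}{\sum_{k\ge0}m(G,k)}$ is the average size of a matching of $G$. $P_n$ is the path on $n$ vertices. *)

(* Defs.v *)
From mathcomp Require Import all_boot all_order all_algebra.

Set Implicit Arguments.
Unset Strict Implicit.
Unset Printing Implicit Defensive.

Import Order.TTheory GRing.Theory Num.Theory.

Record sgraph := SGraph {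
  vertex :> finType;
  adj : rel vertex;
  adj_sym : symmetric adj;
  adj_irr : irreflexive adj
}.

Definition isomorphic (G H : sgraph) : Prop :=
  exists f : G -> H, bijective f /\ forall x y : G, adj (f x) (f y) = adj x y.

(* The null graph is not considered connected. *)
Definition connected (G : sgraph) : Prop :=
  0 < #|G| /\ forall x y : G, connect (@adj G) x y.

(* A closed walk x, y, x along one edge is a ucycle of size 2 for the symmetric
   relation adj; the cycles of the graph are the ucycles of size at least 3. *)
Definition acyclic (G : sgraph) : Prop :=
  forall c : seq G, ucycle (@adj G) c -> size c < 3.

Definition tree (G : sgraph) : Prop := connected G /\ acyclic G.

Definition tree_of_order (n : nat) (G : sgraph) : Prop := tree G /\ #|G| = n.

Definition path_adj (n : nat) : rel 'I_n :=
  fun i j => (i.+1 == j :> nat) || (j.+1 == i :> nat).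

Lemma path_adj_sym n : symmetric (@path_adj n).
Proof. by move=> i j; rewrite /path_adj orbC. Qed.

Lemma path_adj_irr n : irreflexive (@path_adj n).
Proof. by move=> i; rewrite /path_adj orbb eqn_leq ltnn. Qed.

Definition path_graph (n : nat) : sgraph :=
  SGraph (@path_adj_sym n) (@path_adj_irr n).

Definition is_path (G : sgraph) : Prop :=
  exists n : nat, isomorphic G (path_graph n).

Definition edges (G : sgraph) : {set {set G}} :=
  [set [set x; y] | x in G, y in G & adj x y].

Definition matching (G : sgraph) (M : {set {set G}}) : bool :=
  (M \subset edges G) && trivIset M.

Definition num_matchings (G : sgraph) (k : nat) : nat :=
  #|[set M : {set {set G}} | matching M & #|M| == k]|.

Local Open Scope ring_scope.

(* num_matchings G k = 0 for k > #|edges G|, so these are the full sums over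
   all k; the denominator is positive because set0 is a matching. *)
Definition av (R : numFieldType) (G : sgraph) : R :=
  (\sum_(0 <= k < #|edges G|.+1) (k * num_matchings G k)%:R) /
  (\sum_(0 <= k < #|edges G|.+1) (num_matchings G k)%:R).

(* Main.v *)
Require Import Defs.
From mathcomp Require Import all_boot all_order all_algebra.
From HB Require Import structures.
From mathcomp Require Import ring lra zify.

Set Implicit Arguments.
Unset Strict Implicit.
Unset Printing Implicit Defensive.

Import Order.TTheory GRing.Theory Num.Theory.
Local Open Scope ring_scope.

(** Write [phi = (sqrt 5 - 1) / 2], so that [phi ^ 2 = 1 - phi], [a = (2 - phi) / 5]
    and [- b = 1 - 7 phi / 5].  For a rooted tree [t] with matching polynomial [p],
    and [q] that of [t] minus its root, put [tau = q / p], [eps = 1 + q'/q - p'/p]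
    and [defect = a n - p'/p], all at [1]; these obey a recursion in the branches at
    the root.  Glueing an infinitely long path to the root changes the defect by an
    explicit function of [tau] and [eps]; what remains, the [excess], is zero for a
    path rooted at an end, is unchanged when a new root is put on top of [t], and at
    a branching vertex is a sum over the branches of terms that are essentially
    nonnegative.  Hence the excess of any other rooted tree is at least
    [c0 = (7 - 11 phi) / 10], the value for two branches with two vertices each.
    Finally, choose as root a branching vertex all of whose branches but one are
    paths.  The defect is then the excess of the last branch plus an explicit
    rational function of the [tau]s and [eps]s, whose minimum [- b] is attained by
    the spider with three legs of length 2. *)

(** * Rooted trees *)

(* [Join t1 t2] hangs [t2] below the root of [t1] as one more branch; rerooting is
   then the exchange of [t1] and [t2]. *)
Inductive rtree := Leaf | Join of rtree & rtree.

Lemma rtree_comparable : comparable rtree.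
Proof. by rewrite /comparable /decidable; decide equality. Qed.

HB.instance Definition _ := hasDecEq.Build rtree (compareP rtree_comparable).

Fixpoint nverts t : nat :=
  if t is Join t1 t2 then (nverts t1 + nverts t2)%N else 1%N.

Fixpoint kids t : seq rtree :=
  if t is Join t1 t2 then t2 :: kids t1 else [::].

Definition node (s : seq rtree) : rtree := foldr (fun k t => Join t k) Leaf s.

Lemma kids_node s : kids (node s) = s.
Proof. by elim: s => //= k s ->. Qed.

(** The built-in induction on [Join t1 t2] gives a hypothesis for [t1], which is not a branch. Here
    it proves [P] for all branches at once, and induction over branches follows. *)
Lemma kids_ind (P : rtree -> Prop) :
  (forall t, {in kids t, forall k, P k} -> P t) -> forall t, P t.
Proof.
move=> IH t; apply: (IH); elim: t => [//|t1 IH1 t2 IH2] k /=.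
by rewrite inE => /orP[/eqP->|/IH1//]; apply: IH.
Qed.

Fixpoint end_path t : bool :=
  match t with
  | Leaf => true
  | Join Leaf t2 => end_path t2
  | Join (Join _ _) _ => false
  end.

Lemma end_pathP t :
  end_path t = (kids t == [::]) || ((size (kids t) == 1%N) && all end_path (kids t)).
Proof. by case: t => [//|[|t1 t2] t3] //=; rewrite andbT. Qed.

Section RootedTrees.
Variables (R : realFieldType) (phi : R).
Hypotheses (phi_gt0 : 0 < phi) (phi2 : phi ^+ 2 = 1 - phi).

(* The fraction of the matchings of [t] that leave the root uncovered. *)
Fixpoint tau t : R :=
  if t is Join t1 t2 then tau t1 / (1 + tau t1 * tau t2) else 1.

(* The increase of the average caused by an edge between the roots of two trees with
   parameters [tau = x1, eps = e1] and [tau = x2, eps = e2]. *)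
Definition edge_gain (x1 e1 x2 e2 : R) : R :=
  x1 * x2 * (e1 + e2 - 1) / (1 + x1 * x2).

Fixpoint eps t : R :=
  if t is Join t1 t2 then
    eps t1 - edge_gain (tau t1) (eps t1) (tau t2) (eps t2)
  else 1.

Fixpoint mean t : R :=
  if t is Join t1 t2 then
    mean t1 + mean t2 + edge_gain (tau t1) (eps t1) (tau t2) (eps t2)
  else 0.

Local Notation a := ((2 - phi) / 5).

Definition defect t : R := a * (nverts t)%:R - mean t.

(* The limit of [defect (Join t u) - defect u] over long paths [u] is [defect t] minus
   this quantity, which also is the defect of a path rooted at an end. *)
Definition leg_defect (x e : R) : R := phi * x * (e - a) / (1 + phi * x).

Definition excess t : R := defect t - leg_defect (tau t) (eps t).

Lemma phi_lb : 309 / 500 < phi.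
Proof. by move: phi_gt0 phi2 => h0 h2; nra. Qed.

Lemma phi_ub : phi < 619 / 1000.
Proof. by move: phi_gt0 phi2 => h0 h2; nra. Qed.

Lemma defect_Join t1 t2 :
  defect (Join t1 t2) = defect t1 + defect t2 -
    edge_gain (tau t1) (eps t1) (tau t2) (eps t2).
Proof. by rewrite /defect /= natrD; ring. Qed.

Lemma defect_JoinC t1 t2 : defect (Join t1 t2) = defect (Join t2 t1).
Proof.
rewrite !defect_Join [defect t2 + _]addrC /edge_gain [tau t2 * _]mulrC.
by rewrite [eps t2 + _]addrC.
Qed.

Lemma tau_gt0 t : 0 < tau t.
Proof.
elim: t => [|t1 h1 t2 h2] /=; first by rewrite ltr01.
by rewrite divr_gt0 // addr_gt0 // mulr_gt0.
Qed.

(** * Recursion over all branches at the root *)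

Definition kid_tau t : R := \sum_(k <- kids t) tau k.
Definition kid_sum t : R := \sum_(k <- kids t) tau k * eps k.

Lemma kid_tau_ge0 t : 0 <= kid_tau t.
Proof. by apply: sumr_ge0 => k _; exact: ltW (tau_gt0 k). Qed.

Lemma kid_tau_Join t1 t2 : kid_tau (Join t1 t2) = tau t2 + kid_tau t1.
Proof. exact: big_cons. Qed.

Lemma kid_sum_Join t1 t2 : kid_sum (Join t1 t2) = tau t2 * eps t2 + kid_sum t1.
Proof. exact: big_cons. Qed.

Lemma tau_kids t : tau t = (1 + kid_tau t)^-1.
Proof.
elim: t => [|t1 IH t2 _]; first by rewrite /kid_tau big_nil addr0 invr1.
rewrite kid_tau_Join /= IH.
have h1 := kid_tau_ge0 t1; have h2 := tau_gt0 t2.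
by field; apply/andP; split; apply: lt0r_neq0; lra.
Qed.

Lemma eps_kids t : eps t = 1 - kid_sum t / (1 + kid_tau t).
Proof.
elim: t => [|t1 IH t2 _]; first by rewrite /kid_sum big_nil mul0r subr0.
rewrite kid_tau_Join kid_sum_Join /= IH /edge_gain (tau_kids t1).
have h1 := kid_tau_ge0 t1; have h2 := tau_gt0 t2.
by field; apply/andP; split; apply: lt0r_neq0; lra.
Qed.

(** The matching polynomial of [t] is the product of those of its branches times
    [1 + X * \sum_k q_k / p_k]. At 1 the derivative of [q_k / p_k] is [tau k * (eps k - 1)], so the
    last factor has logarithmic derivative [kid_sum t / (1 + kid_tau t)]. *)
Lemma defect_kids t :
  defect t = \sum_(k <- kids t) defect k + a - kid_sum t / (1 + kid_tau t).
Proof.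
elim: t => [|t1 IH t2 _].
  by rewrite /defect /kid_sum !big_nil /=; ring.
rewrite defect_Join IH kid_tau_Join kid_sum_Join /= big_cons.
rewrite (eps_kids t1) /edge_gain (tau_kids t1).
have h1 := kid_tau_ge0 t1; have h2 := tau_gt0 t2.
by field; apply/andP; split; apply: lt0r_neq0; lra.
Qed.

(** The contribution of the branch [k] when [s] is the sum of [tau] over all branches. The factor
    after [leg_defect] vanishes if [k] is the only branch. *)
Definition kid_excess (s : R) k : R :=
  excess k + leg_defect (tau k) (eps k) * (phi * (s - tau k) / (1 + phi * s)).

Lemma excess_kids t :
  excess t = \sum_(k <- kids t) kid_excess (kid_tau t) k.
Proof.
have s0 := kid_tau_ge0 t.
(* Each term equals [defect k - phi * tau k * (eps k - a) / (1 + phi * s)], because 1 minus the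
   factor in [kid_excess] is [(1 + phi * tau k) / (1 + phi * s)]. *)
have -> (s : R) : 0 <= s -> \sum_(k <- kids t) kid_excess s k =
    \sum_(k <- kids t) defect k -
    phi / (1 + phi * s) * (kid_sum t - a * kid_tau t).
- move=> hs0; rewrite /kid_sum /kid_tau mulr_sumr -sumrB mulr_sumr -sumrB.
  apply: eq_bigr => k _; rewrite /kid_excess /excess /leg_defect.
  have h := tau_gt0 k; have hs : 0 <= phi * s by rewrite mulr_ge0 // ltW.
  have ht : 0 < phi * tau k by rewrite mulr_gt0.
  by field; apply/andP; split; apply: lt0r_neq0; lra.
- have hs : 0 <= phi * kid_tau t by rewrite mulr_ge0 // ltW.
  rewrite /excess /leg_defect defect_kids eps_kids tau_kids.
  have p0 := phi_gt0; move: (kid_tau t) (kid_sum t) s0 hs => s q s0 hs.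
  (* The denominators match because [phi * (1 + s + phi) = 1 + phi * s]. *)
  by field: phi2; apply/and3P; split; apply: lt0r_neq0; lra.
- exact: s0.
Qed.

(** * Bounds on [tau] and [eps] *)

Lemma kid_tau_ge t k : k \in kids t -> tau k <= kid_tau t.
Proof.
move=> kt; rewrite /kid_tau (big_rem k kt) /= lerDl.
by apply: sumr_ge0 => i _; exact: ltW (tau_gt0 i).
Qed.

Lemma tau_le1 t : tau t <= 1.
Proof. by rewrite tau_kids invf_le1 ?lerDl ?kid_tau_ge0 // ltr_wpDr // kid_tau_ge0. Qed.

(** By induction [kid_sum t] lies between 0 and [kid_tau t], and [1 - kid_tau t / (1 + kid_tau t)]
    is [tau t]. *)
Lemma eps_bounds t : tau t <= eps t <= 1.
Proof.
elim/kids_ind: t => t IH; have s0 := kid_tau_ge0 t.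
have s1 : 0 < 1 + kid_tau t by lra.
have q0 : 0 <= kid_sum t.
  rewrite /kid_sum big_seq; apply: sumr_ge0 => k /IH /andP[h _].
  by rewrite mulr_ge0 ?(le_trans _ h) // ltW // tau_gt0.
have qs : kid_sum t <= kid_tau t.
  rewrite /kid_sum /kid_tau big_seq [leRHS]big_seq; apply: ler_sum => k /IH /andP[_ h].
  by rewrite ler_piMr // ltW // tau_gt0.
rewrite eps_kids tau_kids; apply/andP; split; last by rewrite gerBl divr_ge0 // ltW.
rewrite lerBrDr -[X in X + _]mul1r -mulrDl ler_pdivrMr // mul1r; lra.
Qed.

Lemma eps_ge_tau t : tau t <= eps t. Proof. by case/andP: (eps_bounds t). Qed.

Lemma end_path_kids t : end_path t ->
  kids t = [::] \/ exists2 k, end_path k & kids t = [:: k].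
Proof.
rewrite end_pathP => /orP[/eqP|]; first by left.
by case: (kids t) => [|k [|]] //= /andP[kp _]; right; exists k.
Qed.

Lemma end_path_tau t : end_path t -> 1 / 2 <= tau t.
Proof.
case/end_path_kids => [|[k _]] kt; rewrite tau_kids /kid_tau kt.
  by rewrite big_nil addr0 invr1; lra.
rewrite big_seq1 mul1r lef_pV2 ?posrE; have := tau_gt0 k; have := tau_le1 k; lra.
Qed.

Lemma end_path_excess t : end_path t -> excess t = 0.
Proof.
elim/kids_ind: t => t IH tp; rewrite excess_kids.
case/end_path_kids: tp => [->|[k kp kt]]; first by rewrite big_nil.
rewrite kt big_seq1 /kid_excess IH ?kt ?mem_head // add0r /kid_tau kt big_seq1.
by rewrite subrr mulr0 mul0r mulr0.
Qed.

(** * Lower bound for the excess *)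

(* [d2] is the defect of the path on two vertices. *)
Local Notation d2 := ((3 - 4 * phi) / 10).
Local Notation c0 := ((7 - 11 * phi) / 10).

(** The factor [1 - phi] is [phi / (1 + phi)], the sum of the factors in [kid_excess] for two
    branches with [tau = 1 / 2]. *)
Lemma c0E : c0 = d2 * (1 - phi).
Proof. by have := phi2; rewrite expr2; lra. Qed.

(** The minimum is at [x = e = 1 / 2], the path on two vertices; [(6 * phi - 2) / 10] is
    [1 / 2 - a - d2]. *)
Lemma leg_defect_ge x e : 1 / 2 <= x -> x <= e -> d2 <= leg_defect x e.
Proof.
move=> hx he; have p1 := phi_lb; have p2 := phi_ub; have h0 := phi_gt0.
have px : phi * (1 / 2) <= phi * x by rewrite ler_wpM2l // ltW.
rewrite ler_pdivlMr; last by lra.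
have : phi * (1 / 2) * ((6 * phi - 2) / 10) <= phi * x * (e - a - d2).
  by apply: ler_pM => //; lra.
by have := phi2; rewrite expr2 => ?; lra.
Qed.

Lemma share_bounds (s x : R) : 0 <= x <= s ->
  0 <= phi * (s - x) / (1 + phi * s) <= 1.
Proof.
move=> /andP[x0 xs]; have px : 0 <= phi * x by rewrite mulr_ge0 // ltW.
have ps : phi * x <= phi * s by rewrite ler_wpM2l // ltW.
by apply/andP; split; [rewrite divr_ge0 // | rewrite ler_pdivrMr]; lra.
Qed.

Lemma kid_excess_path (s : R) k : end_path k -> tau k <= s ->
  d2 * (phi * (s - tau k) / (1 + phi * s)) <= kid_excess s k.
Proof.
move=> kp ks; rewrite /kid_excess end_path_excess // add0r; have h0 := phi_gt0.
have t0 := tau_gt0 k.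
rewrite ler_wpM2r ?leg_defect_ge ?end_path_tau ?eps_ge_tau //.
by have /andP[] : 0 <= phi * (s - tau k) / (1 + phi * s) <= 1 by apply: share_bounds; lra.
Qed.

(** A negative [leg_defect] forces [tau k <= eps k < a]. Then the excess is at least [3 * c0], and
    the loss, at most [1 / 50], is covered by the spare [2 * c0]. *)
Lemma kid_excess_nonpath (s : R) k : tau k <= s ->
  c0 <= excess k -> (tau k < a -> 3 * c0 <= excess k) -> c0 <= kid_excess s k.
Proof.
move=> ks ck ck'; have h0 := phi_gt0; have t0 := tau_gt0 k; have te := eps_ge_tau k.
have p1 := phi_lb; have p2 := phi_ub.
have pt : 0 < phi * tau k by rewrite mulr_gt0.
have /andP[r0 r1] : 0 <= phi * (s - tau k) / (1 + phi * s) <= 1.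
  by apply: share_bounds; lra.
rewrite /kid_excess; have [ae|ea] := leP a (eps k).
  have d0 : 0 <= leg_defect (tau k) (eps k) by rewrite divr_ge0 ?mulr_ge0 //; lra.
  by have := mulr_ge0 d0 r0; lra.
have {}ck' : 3 * c0 <= excess k by apply: ck'; lra.
have d1 : - (1 / 50) <= leg_defect (tau k) (eps k).
  rewrite ler_pdivlMr; last by lra.
  have : phi * tau k * (a - eps k) <= phi * tau k * (a - tau k).
    by rewrite ler_wpM2l; lra.
  have : phi * (tau k * (a - tau k)) <= 1 / 50 by nra.
  by lra.
have := ler_wpM2r r0 d1; lra.
Qed.

(** The second clause strengthens the induction: a branch with small [tau] can have [eps] below [a]
    and contribute less than its excess. *)
Lemma excess_bound t : ~~ end_path t ->
  c0 <= excess t /\ (tau t < a -> 3 * c0 <= excess t).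
Proof.
have p1 := phi_lb; have p2 := phi_ub; have h0 := phi_gt0.
elim/kids_ind: t => t IH tp; rewrite excess_kids.
set s := kid_tau t; have s0 : 0 <= s := kid_tau_ge0 t.
have ps0 : 0 <= phi * s by rewrite mulr_ge0 // ltW.
have ks k : k \in kids t -> tau k <= s := @kid_tau_ge t k.
have kN k : k \in kids t -> ~~ end_path k -> c0 <= kid_excess s k.
  by move=> kt kp; have [h1 h2] := IH k kt kp; apply: kid_excess_nonpath => //; exact: ks.
have kP k : k \in kids t -> end_path k ->
    d2 * (phi * (s - tau k) / (1 + phi * s)) <= kid_excess s k.
  by move=> kt kp; apply: kid_excess_path => //; exact: ks.
have k0 k : k \in kids t -> 0 <= kid_excess s k.
  move=> kt; have [kp|kp] := boolP (end_path k); last by have := kN k kt kp; lra.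
  apply: le_trans (kP k kt kp); rewrite mulr_ge0 //; first by lra.
  have /andP[] // : 0 <= phi * (s - tau k) / (1 + phi * s) <= 1.
  by apply: share_bounds; rewrite ks // ltW // tau_gt0.
split.
  have [/hasP[k kt kp]|] := boolP (has (predC end_path) (kids t)).
    rewrite (big_rem k kt) /= -[c0]addr0 lerD ?kN // big_seq; apply: sumr_ge0 => i.
    by move/mem_rem; exact: k0.
  rewrite -all_predC => /allP kp; have {}kp k : k \in kids t -> end_path k.
    by move/kp; rewrite /= negbK.
  have sz : (1 < size (kids t))%N.
    move: tp; rewrite end_pathP negb_or negb_and -size_eq0.
    have -> /= : all end_path (kids t) by apply/allP.
    by rewrite orbF; case: (kids t) => [|? []].
  have s1 : 1 <= s.
    have : \sum_(k <- kids t) (1 / 2 : R) <= s.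
      rewrite big_seq /s /kid_tau [leRHS]big_seq; apply: ler_sum => k /kp.
      exact: end_path_tau.
    rewrite big_const_seq count_predT iter_addr_0 -mulr_natl => h.
    by move: sz; rewrite -(ler_nat R) => sz; lra.
  (* For [m >= 2] branches the factors sum to [phi * (m - 1) * s / (1 + phi * s)], which is at least
     [1 - phi] since [s >= 1]. *)
  apply: (@le_trans _ _ (\sum_(k <- kids t) d2 * (phi * (s - tau k) / (1 + phi * s)))).
    rewrite -mulr_sumr -mulr_suml -mulr_sumr sumrB big_const_seq count_predT iter_addr_0.
    rewrite -/(kid_tau t) -/s -[s *+ _]mulr_natl.
    have n2 : (2%:R : R) <= (size (kids t))%:R by rewrite ler_nat.
    have ns : 2 * s <= (size (kids t))%:R * s by rewrite ler_wpM2r.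
    rewrite c0E ler_wpM2l //; first by lra.
    rewrite ler_pdivlMr; last by lra.
    have : phi * s <= phi * ((size (kids t))%:R * s - s) by rewrite ler_wpM2l; lra.
    have : phi * phi * s = (1 - phi) * s by rewrite -expr2 phi2.
    have : 0 <= (1 - phi) * (s - 1) by rewrite mulr_ge0 //; lra.
    by lra.
  by rewrite big_seq [leRHS]big_seq; apply: ler_sum => k kt; apply: kP => //; exact: kp.
move=> ta.
(* The bound [2 + phi] is [a^-1 - 1]. *)
have s3 : 2 + phi < s.
  move: ta; rewrite tau_kids -/s invf_plt ?posrE; [|lra|lra].
  have : a * (3 + phi) = 1.
    by have := phi2; rewrite expr2; lra.
  move=> h; have /divr1_eq -> : a^-1 / (3 + phi) = 1 by rewrite -invfM h invr1.
  lra.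
(* Every branch alone yields [c0]: for [tau k = 1] and [s = 2 + phi] the factor is exactly
   [1 - phi]. As [tau] is at most 1 and [s > 2], there are at least three branches. *)
have kc k : k \in kids t -> c0 <= kid_excess s k.
  move=> kt; have [kp|kp] := boolP (end_path k); last exact: kN.
  apply: le_trans (kP k kt kp); have k1 := tau_le1 k.
  rewrite c0E ler_wpM2l //; first by lra.
  rewrite ler_pdivlMr; last by lra.
  have : phi * phi * s = (1 - phi) * s by rewrite -expr2 phi2.
  have : phi * (s - 1) <= phi * (s - tau k) by rewrite ler_wpM2l //; lra.
  have : 2 + phi <= s by exact: ltW.
  have : phi * phi = 1 - phi by rewrite -expr2 phi2.
  nra.
have sz : (3 <= size (kids t))%N.
  rewrite -(ler_nat R).
  have : s <= \sum_(k <- kids t) (1 : R) by apply: ler_sum => k _; exact: tau_le1.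
  rewrite big_const_seq count_predT iter_addr_0 => h.
  rewrite leNgt; apply/negP; rewrite ltr_nat ltnS -(ler_nat R); lra.
apply: (@le_trans _ _ (\sum_(k <- kids t) c0)).
  rewrite big_const_seq count_predT iter_addr_0 -[c0 *+ _]mulr_natl.
  by rewrite ler_wpM2r ?ler_nat //; lra.
by rewrite big_seq [leRHS]big_seq; apply: ler_sum => k kt; exact: kc.
Qed.

(** * Branches meeting in one vertex *)

(* The defect of three branches meeting in one vertex, less their excesses. *)
Definition hub (x1 e1 x2 e2 x e : R) : R :=
  leg_defect x1 e1 + leg_defect x2 e2 + leg_defect x e + a -
  (x1 * e1 + x2 * e2 + x * e) / (1 + x1 + x2 + x).

(* Writing the [x]s as lower bound plus nonnegative [A], [B], [C] and reducing powers
   of [phi], all coefficients of the numerator become nonnegative. *)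
Lemma hub_three_legs (x1 x2 x : R) : 1 / 2 <= x1 -> 1 / 2 <= x2 -> 1 / 2 <= x ->
  1 - 7 * phi / 5 <= hub x1 x1 x2 x2 x x.
Proof.
move=> h1 h2 h; have p1 := phi_lb; have p2 := phi_ub; have p0 := phi_gt0.
set A := x1 - 1 / 2; set B := x2 - 1 / 2; set C := x - 1 / 2.
have [A0 [B0 C0]] : 0 <= A /\ 0 <= B /\ 0 <= C by rewrite /A /B /C; lra.
have [-> [-> ->]] : x1 = 1 / 2 + A /\ x2 = 1 / 2 + B /\ x = 1 / 2 + C.
  by rewrite /A /B /C; split; [|split]; ring.
move: A B C A0 B0 C0 => A B C A0 B0 C0 {x1 x2 x h1 h2 h}.
have [pA [pB pC]] : 0 <= phi * A /\ 0 <= phi * B /\ 0 <= phi * C.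
  by split; [|split]; rewrite mulr_ge0 // ltW.
rewrite -subr_ge0; set n := (X in 0 <= X).
have -> : n = (
    (7 + 2 * phi) / 40 * A + (7 + 2 * phi) / 40 * B + (7 + 2 * phi) / 40 * C + (5 +
    4 * phi) / 20 * A ^+ 2 + (15 + 28 * phi) / 20 * A * B + (15 + 28 * phi) / 20 * A
    * C + (5 + 4 * phi) / 20 * B ^+ 2 + (15 + 28 * phi) / 20 * B * C + (5 + 4 * phi)
    / 20 * C ^+ 2 + (6 + 3 * phi) / 5 * A ^+ 2 * B + (6 + 3 * phi) / 5 * A ^+ 2 * C
    + (6 + 3 * phi) / 5 * A * B ^+ 2 + (33 - 36 * phi) / 5 * A * B * C + (6 + 3 *
    phi) / 5 * A * C ^+ 2 + (6 + 3 * phi) / 5 * B ^+ 2 * C + (6 + 3 * phi) / 5 * B *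
    C ^+ 2 + A ^+ 2 * B ^+ 2 + 7 / 5 * A ^+ 2 * B * C + A ^+ 2 * C ^+ 2 + 7 / 5 * A
    * B ^+ 2 * C + 7 / 5 * A * B * C ^+ 2 + B ^+ 2 * C ^+ 2 + (4 * phi - 2) * A ^+ 2
    * B ^+ 2 * C + (4 * phi - 2) * A ^+ 2 * B * C ^+ 2 + (4 * phi - 2) * A * B ^+ 2
    * C ^+ 2) /
    ((1 + phi * (1 / 2 + A)) * (1 + phi * (1 / 2 + B)) * (1 + phi * (1 / 2 + C)) *
     (1 + (1 / 2 + A) + (1 / 2 + B) + (1 / 2 + C))).
  rewrite /n /hub /leg_defect.
  by field: phi2; do ?[apply/andP; split]; apply: lt0r_neq0; lra.
apply: divr_ge0; last by rewrite !mulr_ge0 //; lra.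
by repeat apply: addr_ge0; repeat apply: mulr_ge0; rewrite ?exprn_ge0 ?invr_ge0 //;
clear - phi_gt0 phi2 p0 p1 p2; lra.
Qed.

(** For a third branch that is not a path and has [tau >= a]; its excess supplies the missing [c0].
    The expansion is now around [x = a]. *)
Lemma hub_two_legs (x1 x2 x : R) : 1 / 2 <= x1 -> 1 / 2 <= x2 -> a <= x ->
  1 - 7 * phi / 5 - c0 <= hub x1 x1 x2 x2 x x.
Proof.
move=> h1 h2 h; have p1 := phi_lb; have p2 := phi_ub; have p0 := phi_gt0.
set A := x1 - 1 / 2; set B := x2 - 1 / 2; set C := x - a.
have [A0 [B0 C0]] : 0 <= A /\ 0 <= B /\ 0 <= C by rewrite /A /B /C; lra.
have [-> [-> ->]] : x1 = 1 / 2 + A /\ x2 = 1 / 2 + B /\ x = a + C.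
  by rewrite /A /B /C; split; [|split]; ring.
move: A B C A0 B0 C0 => A B C A0 B0 C0 {x1 x2 x h1 h2 h}.
have [pA [pB pC]] : 0 <= phi * A /\ 0 <= phi * B /\ 0 <= phi * C.
  by split; [|split]; rewrite mulr_ge0 // ltW.
have pa : 0 <= phi * a by rewrite mulr_ge0 //; lra.
rewrite -subr_ge0; set n := (X in 0 <= X).
have -> : n = (
    (1 + phi) / 25 + (7 - 9 * phi) / 200 * A + (7 - 9 * phi) / 200 * B + (43 * phi -
    1) / 200 * C + (11 - 3 * phi) / 100 * A ^+ 2 + (44 + 31 * phi) / 50 * A * B +
    (249 - 87 * phi) / 200 * A * C + (11 - 3 * phi) / 100 * B ^+ 2 + (249 - 87 *
    phi) / 200 * B * C + (9 + 11 * phi) / 40 * C ^+ 2 + (33 + 51 * phi) / 50 * A ^+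
    2 * B + (27 - 7 * phi) / 20 * A ^+ 2 * C + (33 + 51 * phi) / 50 * A * B ^+ 2 +
    (222 * phi - 59) / 50 * A * B * C + (31 + phi) / 20 * A * C ^+ 2 + (27 - 7 *
    phi) / 20 * B ^+ 2 * C + (31 + phi) / 20 * B * C ^+ 2 + (2 + 4 * phi) / 5 * A ^+
    2 * B ^+ 2 + (63 * phi - 27) / 10 * A ^+ 2 * B * C + A ^+ 2 * C ^+ 2 + (63 * phi
    - 27) / 10 * A * B ^+ 2 * C + (47 * phi - 15) / 10 * A * B * C ^+ 2 + B ^+ 2 * C
    ^+ 2 + (4 * phi - 2) * A ^+ 2 * B ^+ 2 * C + (4 * phi - 2) * A ^+ 2 * B * C ^+ 2
    + (4 * phi - 2) * A * B ^+ 2 * C ^+ 2) /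
    ((1 + phi * (1 / 2 + A)) * (1 + phi * (1 / 2 + B)) * (1 + phi * (a + C)) *
     (1 + (1 / 2 + A) + (1 / 2 + B) + (a + C))).
  rewrite /n /hub /leg_defect.
  by field: phi2; do ?[apply/andP; split]; apply: lt0r_neq0; lra.
apply: divr_ge0; last by rewrite !mulr_ge0 //; lra.
by repeat apply: addr_ge0; repeat apply: mulr_ge0; rewrite ?exprn_ge0 ?invr_ge0 //;
clear - phi_gt0 phi2 p0 p1 p2; lra.
Qed.

(** For a third branch with [tau <= a], whose excess is at least [3 * c0]. The extra [1 / 50] pays
    for two uses of [hub_mono_approx]. *)
Lemma hub_small_branch (x1 x2 x : R) : 1 / 2 <= x1 <= 1 -> 1 / 2 <= x2 <= 1 ->
  0 <= x <= a -> 1 - 7 * phi / 5 - 3 * c0 + 1 / 50 <= hub x1 x1 x2 x2 x x.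
Proof.
move=> /andP[h1 h1'] /andP[h2 h2'] /andP[C0 C1].
have p1 := phi_lb; have p2 := phi_ub; have p0 := phi_gt0.
set A := x1 - 1 / 2; set B := x2 - 1 / 2.
have [[A0 B0] [A1 B1]] : (0 <= A /\ 0 <= B) /\ A <= 1 / 2 /\ B <= 1 / 2.
  by rewrite /A /B; lra.
have [-> ->] : x1 = 1 / 2 + A /\ x2 = 1 / 2 + B by rewrite /A /B; split; ring.
move: A B x A0 B0 A1 B1 C0 C1 => A B C A0 B0 A1 B1 C0 C1 {x1 x2 h1 h2 h1' h2'}.
have [pA [pB pC]] : 0 <= phi * A /\ 0 <= phi * B /\ 0 <= phi * C.
  by split; [|split]; rewrite mulr_ge0 // ltW.
rewrite -subr_ge0; set n := (X in 0 <= X).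
have -> : n = ((
    (45 - 31 * phi) / 200 + (298 * phi - 199) / 200 * A + (298 * phi - 199) / 200 *
    B + (19 * phi - 13) / 100 * C + (94 * phi - 71) / 100 * A ^+ 2 + (367 - 514 *
    phi) / 50 * A * B + (94 * phi - 71) / 100 * B ^+ 2) + (
    (186 - 249 * phi) / 200 * A * C + (186 - 249 * phi) / 200 * B * C + (32 + 83 *
    phi) / 200 * C ^+ 2 + (269 - 354 * phi) / 50 * A ^+ 2 * B + (124 - 105 * phi) /
    100 * A ^+ 2 * C + (269 - 354 * phi) / 50 * A * B ^+ 2 + (447 * phi - 235) / 50
    * A * B * C + (224 - 105 * phi) / 100 * A * C ^+ 2 + (124 - 105 * phi) / 100 * B
    ^+ 2 * C + (224 - 105 * phi) / 100 * B * C ^+ 2 + (2 - 2 * phi) * A ^+ 2 * B ^+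
    2 + (503 * phi - 264) / 50 * A ^+ 2 * B * C + A ^+ 2 * C ^+ 2 + (503 * phi -
    264) / 50 * A * B ^+ 2 * C + (703 * phi - 364) / 50 * A * B * C ^+ 2 + B ^+ 2 *
    C ^+ 2 + (4 * phi - 2) * A ^+ 2 * B ^+ 2 * C + (4 * phi - 2) * A ^+ 2 * B * C ^+
    2 + (4 * phi - 2) * A * B ^+ 2 * C ^+ 2)) /
    ((1 + phi * (1 / 2 + A)) * (1 + phi * (1 / 2 + B)) * (1 + phi * C) *
     (1 + (1 / 2 + A) + (1 / 2 + B) + C)).
  rewrite /n /hub /leg_defect.
  by field: phi2; do ?[apply/andP; split]; apply: lt0r_neq0; lra.
apply: divr_ge0; last by rewrite !mulr_ge0 //; lra.
(* The second group has nonnegative coefficients. The first has negative ones as well and needs the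
   upper bounds on [A], [B] and [C]. *)
apply: addr_ge0; last first.
  by repeat apply: addr_ge0; repeat apply: mulr_ge0; rewrite ?exprn_ge0 ?invr_ge0 //;
  clear - phi_gt0 phi2 p0 p1 p2; lra.
have hA : 0 <= A * (1 / 2 - A) by rewrite mulr_ge0 //; lra.
have hB : 0 <= B * (1 / 2 - B) by rewrite mulr_ge0 //; lra.
have hAB : 0 <= (1 / 2 - A) * (1 / 2 - B) by rewrite mulr_ge0 //; lra.
have fA : 0 <= (phi - 309 / 500) * A by rewrite mulr_ge0 //; lra.
have fB : 0 <= (phi - 309 / 500) * B by rewrite mulr_ge0 //; lra.
have fC : 0 <= (phi - 309 / 500) * C by rewrite mulr_ge0 //; lra.
have gA : 0 <= (phi - 309 / 500) * (A * A) by rewrite !mulr_ge0 //; lra.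
have gB : 0 <= (phi - 309 / 500) * (B * B) by rewrite !mulr_ge0 //; lra.
have gAB : 0 <= (619 / 1000 - phi) * (A * B) by rewrite !mulr_ge0 //; lra.
have AB0 : 0 <= A * B by rewrite mulr_ge0.
rewrite !expr2; lra.
Qed.

(** The right side is linear in [e], with a slope of the sign of [x * (phi * (1 + s) - 1)]; moreover
    [phi * (1 + phi) = 1]. *)
Lemma leg_mono (q s x e : R) : 0 <= x <= e -> phi <= s ->
  leg_defect x x - (q + x * x) / (1 + s + x) <=
  leg_defect x e - (q + x * e) / (1 + s + x).
Proof.
move=> /andP[x0 xe] ps; have p0 := phi_gt0.
have px : 0 <= phi * x by rewrite mulr_ge0 // ltW.
rewrite -subr_ge0; set n := (X in 0 <= X).
have -> : n = x * (e - x) * (phi * (1 + s) - 1) / ((1 + phi * x) * (1 + s + x)).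
  by rewrite /n /leg_defect; field; apply/andP; split; apply: lt0r_neq0; lra.
apply: divr_ge0; last by rewrite mulr_ge0; lra.
rewrite !mulr_ge0 //; first by lra.
have : phi * phi <= phi * s by rewrite ler_wpM2l // ltW.
by rewrite -expr2 phi2; lra.
Qed.

(* The coefficient of [e] may be negative here, but only slightly. *)
Lemma leg_mono_approx (q s x e : R) : 0 <= x <= e -> e <= 1 -> 1 / 2 <= s ->
  leg_defect x x - (q + x * x) / (1 + s + x) - 1 / 100 <=
  leg_defect x e - (q + x * e) / (1 + s + x).
Proof.
move=> /andP[x0 xe] e1 hs; have p0 := phi_gt0; have p1 := phi_lb.
have px : 0 <= phi * x by rewrite mulr_ge0 // ltW.
rewrite -subr_ge0; set n := (X in 0 <= X).
have -> : n = (x * (e - x) * (phi * (1 + s) - 1)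
    + (1 + phi * x) * (1 + s + x) / 100) / ((1 + phi * x) * (1 + s + x)).
  by rewrite /n /leg_defect; field; apply/andP; split; apply: lt0r_neq0; lra.
apply: divr_ge0; last by rewrite mulr_ge0; lra.
have h1 : - (73 / 1000) <= phi * (1 + s) - 1.
  have : phi * (3 / 2) <= phi * (1 + s) by rewrite ler_wpM2l; lra.
  lra.
have w0 : 0 <= x * (e - x) by rewrite mulr_ge0 // subr_ge0.
have w1 : x * (e - x) <= x * (1 - x) by rewrite ler_wpM2l //; lra.
have h2 : x * (e - x) * - (73 / 1000) <= x * (e - x) * (phi * (1 + s) - 1).
  by rewrite ler_wpM2l.
have h3 : 309 / 500 * x <= phi * x by rewrite ler_wpM2r // ltW.
have h4 : (1 + 309 / 500 * x) * (3 / 2 + x) <= (1 + phi * x) * (1 + s + x).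
  by apply: ler_pM; lra.
(* The point [17 / 50] is close to the minimiser of the quadratic in [x] left by [w1], [h2] and
   [h4]. *)
have : 0 <= (x - 17 / 50) ^+ 2 by exact: sqr_ge0.
rewrite expr2 => h5; clear - phi_gt0 phi2 x0 w1 h2 h4 h5; lra.
Qed.

(** One more path [y] at a vertex does not lower the defect. Here [x] is [tau] of an arbitrary
    branch, [s] and [q] are the sums of [tau] and [tau * eps], and the legs present have
    [eps >= 1 / 2] and make up [s - x >= 1]. After [e] is lowered to [y], the numerator is expanded
    in the slacks [A], [S], [K]. *)
Lemma add_leg (x s q y e : R) : 0 <= x -> 1 + x <= s -> (s - x) / 2 + x ^+ 2 <= q ->
  1 / 2 <= y <= e -> - (q / (1 + s)) <= leg_defect y e - (q + y * e) / (1 + s + y).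
Proof.
move=> x0 xs sq /andP[y2 ye]; have p0 := phi_gt0; have p1 := phi_lb; have p2 := phi_ub.
apply: le_trans (leg_mono _ _ _); [|by lra..].
set A := y - 1 / 2; set S := s - 1 - x; set K := q - ((s - x) / 2 + x ^+ 2).
have [A0 [S0 K0]] : 0 <= A /\ 0 <= S /\ 0 <= K by rewrite /A /S /K; lra.
have [yE [sE qE]] :
    y = 1 / 2 + A /\ s = 1 + x + S /\ q = 1 / 2 + S / 2 + x ^+ 2 + K.
  by rewrite /A /S /K; split; [|split]; field.
clearbody A S K.
have py : 0 <= phi * y by rewrite mulr_ge0 ?(ltW p0) //; lra.
rewrite -subr_ge0; set n := (X in 0 <= X).
have -> : n = y * (phi * (y - a) * (1 + s) * (1 + s + y)
    + (1 + phi * y) * (q - y * (1 + s))) / ((1 + phi * y) * (1 + s) * (1 + s + y)).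
  rewrite /n /leg_defect.
  by field; do ?[apply/andP; split]; apply: lt0r_neq0; lra.
apply: divr_ge0; last by rewrite !mulr_ge0; lra.
apply: mulr_ge0; first by lra.
set m := (X in 0 <= X).
have -> : m = (2 - 3 * phi) / 4 - (7 * phi - 4) / 10 * x + (6 + 2 * phi) / 5 * x ^+ 2
    + ((33 * phi - 16) / 10 * A + (2 + phi) / 2 * K + (18 - 9 * phi) / 20 * S
    + phi * A * K + (39 * phi - 8) / 10 * A * S + (17 * phi - 4) / 5 * A * x
    + (2 - phi) / 10 * S ^+ 2 + (2 - phi) / 5 * S * x + phi * A * S ^+ 2
    + 2 * phi * A * S * x + 2 * phi * A * x ^+ 2).
  by rewrite /m yE sE qE; field: phi2.
apply: addr_ge0; last first.
  repeat apply: addr_ge0; repeat apply: mulr_ge0; rewrite ?exprn_ge0 ?invr_ge0 //;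
  clear - phi_gt0 phi2 p0 p1 p2; lra.
clear - phi_gt0 phi2 p1 p2 x0.
have h : (7 * phi - 4) / 10 * x <= 1 / 20 * x by rewrite ler_wpM2r; lra.
have h' : 7 / 5 * x ^+ 2 <= (6 + 2 * phi) / 5 * x ^+ 2.
  by rewrite ler_wpM2r ?exprn_ge0 //; lra.
(* Only the linear term in [x] is negative; [1 / 50] is close to the minimiser of
   [7 / 5 * x ^+ 2 - 1 / 20 * x]. *)
have : 0 <= (x - 1 / 50) ^+ 2 by exact: sqr_ge0.
rewrite expr2 in h' *; lra.
Qed.

(** Each new leg preserves the hypotheses on [s] and [q], so [add_leg] can be iterated. *)
Lemma add_legs (x s q : R) (l : seq rtree) : all end_path l ->
  0 <= x -> 1 + x <= s -> (s - x) / 2 + x ^+ 2 <= q ->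
  - (q / (1 + s)) <= \sum_(k <- l) leg_defect (tau k) (eps k) -
    (q + \sum_(k <- l) tau k * eps k) / (1 + s + \sum_(k <- l) tau k).
Proof.
move=> + x0; elim: l s q => [|k l IH] s q /=.
  by rewrite !big_nil !addr0 sub0r.
case/andP=> kp lp xs sq; rewrite !big_cons.
have k2 := end_path_tau kp; have ke := eps_ge_tau k.
have kk : tau k * (1 / 2) <= tau k * eps k 
  by apply: ler_wpM2l; [exact/ltW/tau_gt0 | lra].
have h1 : - (q / (1 + s)) <= leg_defect (tau k) (eps k) -
    (q + tau k * eps k) / (1 + s + tau k).
  by apply: (@add_leg x) => //; rewrite k2.
have h2 : - ((q + tau k * eps k) / (1 + s + tau k)) <=
    \sum_(j <- l) leg_defect (tau j) (eps j) -
    (q + (tau k * eps k + \sum_(j <- l) tau j * eps j)) /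
      (1 + s + (tau k + \sum_(j <- l) tau j)).
  rewrite !addrA -(addrA 1 s); apply: IH => //; lra.
lra.
Qed.

Lemma defect_excess t :
  defect t = excess t + leg_defect (tau t) (eps t).
Proof. by rewrite subrK. Qed.

(** Isolates the dependence on [e1] in the shape treated by [leg_mono]. *)
Lemma hub_split x1 e1 x2 e2 x e : hub x1 e1 x2 e2 x e =
  leg_defect x2 e2 + leg_defect x e + a +
  (leg_defect x1 e1 - (x2 * e2 + x * e + x1 * e1) / (1 + (x2 + x) + x1)).
Proof.
rewrite /hub; have -> : 1 + x1 + x2 + x = 1 + (x2 + x) + x1 by ring.
have -> : x1 * e1 + x2 * e2 + x * e = x2 * e2 + x * e + x1 * e1 by ring.
by ring.
Qed.

Lemma hub_rot x1 e1 x2 e2 x e : hub x1 e1 x2 e2 x e = hub x2 e2 x e x1 e1.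
Proof.
rewrite /hub; have -> : 1 + x1 + x2 + x = 1 + x2 + x + x1 by ring.
have -> : x1 * e1 + x2 * e2 + x * e = x2 * e2 + x * e + x1 * e1 by ring.
by ring.
Qed.

Lemma hub_mono x1 e1 x2 e2 x e : 0 <= x1 <= e1 -> phi <= x2 + x ->
  hub x1 x1 x2 e2 x e <= hub x1 e1 x2 e2 x e.
Proof. by move=> *; rewrite !hub_split lerD2l leg_mono. Qed.

Lemma hub_mono_approx x1 e1 x2 e2 x e : 0 <= x1 <= e1 -> e1 <= 1 -> 1 / 2 <= x2 + x ->
  hub x1 x1 x2 e2 x e - 1 / 100 <= hub x1 e1 x2 e2 x e.
Proof. by move=> *; rewrite !hub_split -addrA lerD2l leg_mono_approx. Qed.

(** As [x1 + x2 >= 1], [eps u] may be lowered to [tau u]. If [tau u >= a], then [e1] and [e2] may be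
    lowered to [x1] and [x2] as well, and [u] is a path or has excess at least [c0]. Otherwise the
    latter two replacements cost [1 / 100] each. *)
Lemma hub_bound (x1 e1 x2 e2 : R) u :
  1 / 2 <= x1 -> x1 <= e1 <= 1 -> 1 / 2 <= x2 -> x2 <= e2 <= 1 ->
  1 - 7 * phi / 5 <= excess u + hub x1 e1 x2 e2 (tau u) (eps u).
Proof.
move=> x12 /andP[xe1 e11] x22 /andP[xe2 e21].
have p0 := phi_gt0; have p1 := phi_lb; have p2 := phi_ub.
have u0 := tau_gt0 u; have ue := eps_ge_tau u.
rewrite -hub_rot -lerBlDl.
have hu : hub (tau u) (tau u) x1 e1 x2 e2 <= hub (tau u) (eps u) x1 e1 x2 e2.
  by apply: hub_mono; lra.
apply: le_trans hu; rewrite hub_rot.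
have [au|ua] := leP a (tau u).
  apply: le_trans (hub_mono _ _ _ _); [|by lra|by lra]; rewrite hub_rot.
  apply: le_trans (hub_mono _ _ _ _); [|by lra|by lra]; rewrite -hub_rot.
  have [up|up] := boolP (end_path u).
    rewrite end_path_excess // subr0; apply: hub_three_legs => //.
    exact: end_path_tau.
  have [c1 _] := excess_bound up.
  by have := hub_two_legs x12 x22 au; lra.
have up : ~~ end_path u by apply/negP => /end_path_tau; lra.
have [_ /(_ ua) c3] := excess_bound up.
have h1 : hub x1 x1 x2 e2 (tau u) (tau u) - 1 / 100 <= hub x1 e1 x2 e2 (tau u) (tau u).
  by apply: hub_mono_approx; lra.
have h2 : hub x2 x2 (tau u) (tau u) x1 x1 - 1 / 100 <= hub x2 e2 (tau u) (tau u) x1 x1.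
  by apply: hub_mono_approx; lra.
rewrite -[hub x2 x2 _ _ _ _]hub_rot -[hub x2 e2 _ _ _ _]hub_rot in h2.
have h3 : 1 - 7 * phi / 5 - 3 * c0 + 1 / 50 <= hub x1 x1 x2 x2 (tau u) (tau u).
  by apply: hub_small_branch; lra.
lra.
Qed.

(** Two of the paths together with [u] are handled by [hub_bound], the remaining paths by
    [add_legs]. *)
Lemma defect_hub u t : (1 < size (kids t))%N -> all end_path (kids t) ->
  1 - 7 * phi / 5 <= defect (Join t u).
Proof.
move=> sz tp; rewrite defect_kids /kid_tau /kid_sum /= !big_cons.
rewrite (eq_big_seq (fun k => leg_defect (tau k) (eps k))); last first.
  by move=> k /(allP tp) kp; rewrite defect_excess end_path_excess // add0r.
case: (kids t) sz tp => [|k1 [|k2 l]] //= _ /and3P[kp1 kp2 lp]; rewrite !big_cons.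
have [t1 t2] := (end_path_tau kp1, end_path_tau kp2).
have [e1 e2] := (eps_bounds k1, eps_bounds k2).
have h := hub_bound u t1 e1 t2 e2.
have u0 := tau_gt0 u; have ue := eps_ge_tau u.
case/andP: e1 => e1 _; case/andP: e2 => e2 _.
have q1 : tau k1 * (1 / 2) <= tau k1 * eps k1 by rewrite ler_wpM2l //; lra.
have q2 : tau k2 * (1 / 2) <= tau k2 * eps k2 by rewrite ler_wpM2l //; lra.
have qu : tau u * tau u <= tau u * eps u by rewrite ler_wpM2l // ltW.
have hs : 1 + tau u <= tau k1 + tau k2 + tau u by lra.
have hq : (tau k1 + tau k2 + tau u - tau u) / 2 + tau u ^+ 2 <=
    tau k1 * eps k1 + tau k2 * eps k2 + tau u * eps u by rewrite expr2; lra.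
have hl := add_legs lp (ltW u0) hs hq.
move: h hl; rewrite defect_excess /hub.
have -> : 1 + (tau k1 + tau k2 + tau u) = 1 + tau k1 + tau k2 + tau u by ring.
set X := \sum_(j <- l) tau j; set Y := \sum_(j <- l) tau j * eps j.
have -> : 1 + (tau u + (tau k1 + (tau k2 + X))) = 1 + tau k1 + tau k2 + tau u + X by ring.
have -> : tau u * eps u + (tau k1 * eps k1 + (tau k2 * eps k2 + Y)) =
   tau k1 * eps k1 + tau k2 * eps k2 + tau u * eps u + Y by ring.
by clear - phi_gt0 phi2 => h hl; lra.
Qed.

(* Induction descends into a branch that is not a path, turning the rest of the tree
   into the new [u]. *)
Lemma defect_lb t : ~~ end_path t -> forall u, 1 - 7 * phi / 5 <= defect (Join t u).
Proof.
elim/kids_ind: t => t IH tp u.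
have [/hasP[k kt kp]|] := boolP (has (predC end_path) (kids t)).
  (* Both sides describe one tree, rooted at the root of [t] and at that of [k]. Exchanging the
     arguments on the right gives the same branches up to order. *)
  suff -> : defect (Join t u) = defect (Join k (node (u :: rem k (kids t)))).
    exact: IH.
  rewrite [RHS]defect_JoinC !defect_kids /kid_tau /kid_sum /= kids_node !big_cons.
  rewrite !(perm_big _ (perm_to_rem kt)) /= !big_cons.
  by congr (_ + _ - _ / (_ + _)); exact: addrCA.
rewrite -all_predC => /allP kp; have {}kp : all end_path (kids t).
  by apply/allP => k /kp; rewrite /= negbK.
apply: defect_hub => //; move: tp; rewrite end_pathP kp andbT.
by case: (kids t) => [|? []].
Qed.

(** * The defect of long paths *)

Lemma tau_JoinLeaf t : tau (Join Leaf t) = 1 / (1 + tau t).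
Proof. by rewrite /= !mul1r. Qed.

Lemma eps_JoinLeaf t : eps (Join Leaf t) = 1 - tau t * eps t / (1 + tau t).
Proof. by rewrite /= /edge_gain !mul1r addrAC subrr add0r. Qed.

Local Notation end_path_of n := (iter n (Join Leaf) Leaf).

(** Putting a new root on top maps this box for [tau] and [eps] into itself, and the path on four
    vertices lies in it. *)
Lemma long_path_state n :
  3 / 5 <= tau (end_path_of n.+3) <= 5 / 8 /\
  2 / 3 <= eps (end_path_of n.+3) <= 3 / 4.
Proof.
elim: n => [|n [/andP[h1 h2] /andP[h3 h4]]].
  have T1 : tau (end_path_of 1) = 1 / 2 by rewrite tau_JoinLeaf.
  have E1 : eps (end_path_of 1) = 1 / 2 by rewrite eps_JoinLeaf /=; field.
  have T2 : tau (end_path_of 2) = 2 / 3 by rewrite tau_JoinLeaf T1; field.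
  have E2 : eps (end_path_of 2) = 5 / 6 by rewrite eps_JoinLeaf T1 E1; field.
  have -> : tau (end_path_of 3) = 3 / 5 by rewrite tau_JoinLeaf T2; field.
  have -> : eps (end_path_of 3) = 2 / 3 by rewrite eps_JoinLeaf T2 E2; field.
  by lra.
rewrite [iter n.+4 _ _]iterS tau_JoinLeaf eps_JoinLeaf.
move: (tau _) (eps _) h1 h2 h3 h4 => x e h1 h2 h3 h4.
have u0 : x / (1 + x) = 1 - 1 / (1 + x) by field; apply: lt0r_neq0; lra.
have u1 : 8 / 13 <= 1 / (1 + x) by rewrite ler_pdivlMr; lra.
have u2 : 1 / (1 + x) <= 5 / 8 by rewrite ler_pdivrMr; lra.
rewrite mulrAC u0; move: (1 / (1 + x)) u1 u2 => y u1 u2.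
by split; apply/andP; split; nra.
Qed.

(** The excess being 0, the defect is [leg_defect]. On the box of [long_path_state] it is largest at
    [(5 / 8, 3 / 4)], where it is still below the bound. *)
Lemma long_path_defect n : defect (end_path_of n.+3) <= 1 - 7 * phi / 5.
Proof.
have p0 := phi_gt0; have p1 := phi_lb; have p2 := phi_ub.
have ep : end_path (end_path_of n.+3) by elim: n.
rewrite defect_excess end_path_excess // add0r.
have [/andP[h1 h2] /andP[h3 h4]] := long_path_state n.
move: (tau _) (eps _) h1 h2 h3 h4 => x e h1 h2 h3 h4 {ep}.
have px : phi * x <= phi * (5 / 8) by rewrite ler_wpM2l // ltW.
have px0 : phi * (3 / 5) <= phi * x by rewrite ler_wpM2l // ltW.
rewrite ler_pdivrMr; last by lra.
have : phi * x * (e - a) <= phi * x * (3 / 4 - a) by rewrite ler_wpM2l; lra.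
have : phi * x * phi = (1 - phi) * x by rewrite mulrAC -expr2 phi2.
have : 309 / 500 * x <= phi * x by rewrite ler_wpM2r; lra.
by lra.
Qed.

End RootedTrees.

Lemma end_path_iter t : end_path t -> exists n, t = iter n (Join Leaf) Leaf.
Proof.
elim: t => [|[|t1 t1'] _ t2 IH] //=; first by exists 0%N.
by move=> /IH[n ->]; exists n.+1.
Qed.

Lemma nverts_iter n : nverts (iter n (Join Leaf) Leaf) = n.+1.
Proof. by elim: n => //= n ->. Qed.

Lemma nverts_gt0 t : (0 < nverts t)%N.
Proof. by elim: t => //= t1 h1 t2 _; rewrite addn_gt0 h1. Qed.

Lemma nonpath_nverts t : ~~ end_path t -> (2 < nverts t)%N.
Proof.
elim: t => [//|[|t1 t2] _ t3 IH] //=; first by move/IH => h; exact: ltnW.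
by have := (nverts_gt0 t1, nverts_gt0 t2, nverts_gt0 t3) => -[[]]; lia.
Qed.

(** * Matching polynomials *)

Section MatchingPolynomial.
Variables (R : realFieldType) (V : finType).
Implicit Types (E M : {set {set V}}) (e f : {set V}).

(** Defined for any family of sets, so that edges can be removed one by one. The value at 1 counts
    the matchings, the derivative at 1 adds up their sizes. *)
Definition matchpoly E : {poly R} :=
  \sum_(M : {set {set V}} | (M \subset E) && trivIset M) 'X^#|M|.

Lemma matchpoly0 : matchpoly set0 = 1.
Proof.
rewrite /matchpoly (bigD1 set0) /=; last first.
  by rewrite sub0set; apply/trivIsetP => A B; rewrite inE.
by rewrite cards0 expr0 big1 ?addr0 // => M /andP[/andP[]]; rewrite subset0 => ->.
Qed.

Lemma trivIset_setU1 e M : e \notin M ->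
  trivIset (e |: M) = trivIset M && [forall f in M, [disjoint e & f]].
Proof.
move=> eM; apply/idP/andP => [tr|[tr /forall_inP dj]].
  split; first exact: trivIsetS (subsetUr _ _) tr.
  apply/forall_inP => f fM; apply: (trivIsetP tr); rewrite ?setU11 ?setU1r //.
  by apply: contraNneq eM => ->.
apply/trivIsetP => A B; rewrite !in_setU1 => /orP[/eqP->|AM] /orP[/eqP->|BM].
- by rewrite eqxx.
- by move=> _; exact: dj.
- by move=> _; rewrite disjoint_sym; exact: dj.
- exact: (trivIsetP tr).
Qed.

(** Matchings are split by whether they contain [e]; those that do are [e] plus a matching of the
    edges disjoint from [e]. *)
Lemma matchpolyU1 e E : e \notin E ->
  matchpoly (e |: E) = matchpoly E + 'X * matchpoly [set f in E | [disjoint e & f]].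
Proof.
move=> eE; rewrite /matchpoly (bigID (fun M : {set {set V}} => e \in M)) /= addrC; congr (_ + _).
  apply: eq_bigl => M; rewrite andbAC; congr (_ && _).
  apply/andP/idP => [[sM eM]|sM].
    apply/subsetP => f fM; move/subsetP/(_ f fM): sM; rewrite in_setU1 => /orP[/eqP fe|//].
    by rewrite -fe fM in eM.
  by split; [apply: subset_trans sM (subsetUr _ _) | apply: contra eE; exact: (subsetP sM)].
rewrite (reindex_onto (fun M => e |: M) (fun M => M :\ e)) /=; last first.
  by move=> M /andP[_ eM]; rewrite setD1K.
rewrite mulr_sumr; apply: eq_big => M; last first.
  move=> /andP[_ /eqP eM]; rewrite cardsU1 -eM setD11 exprD expr1.
  by rewrite eM.
apply/idP/idP.
  case/andP => /andP[/andP[sM tr] _] /eqP ME.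
  have eM : e \notin M by rewrite -ME setD11.
  move: tr; rewrite trivIset_setU1 // => /andP[-> /forall_inP dj]; rewrite andbT.
  apply/subsetP => f fM; rewrite inE dj // andbT.
  have := subsetP sM f (setU1r _ fM); rewrite in_setU1 => /orP[/eqP fe|//].
  by rewrite -fe fM in eM.
case/andP => /subsetP sM tr.
have eM : e \notin M by apply: contra eE => /sM; rewrite inE => /andP[].
rewrite setU1K // eqxx setU11 !andbT trivIset_setU1 // tr /=; apply/andP; split.
  by apply: setUS; apply/subsetP => f /sM; rewrite inE => /andP[].
by apply/forall_inP => f /sM; rewrite inE => /andP[].
Qed.

(** Edges of [E1] are peeled off with [matchpolyU1]; all of [E2] survives each time. Distinctness is
    asked for separately because the empty set is disjoint from itself. *)
Lemma matchpolyU E1 E2 :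
  (forall e f, e \in E1 -> f \in E2 -> (e != f) && [disjoint e & f]) ->
  matchpoly (E1 :|: E2) = matchpoly E1 * matchpoly E2.
Proof.
move: {2}#|E1|.+1 (ltnSn #|E1|) => n; elim: n E1 => // n IH E1 cE dj.
have [->|[e eE]] := set_0Vmem E1; first by rewrite set0U matchpoly0 mul1r.
have djS (F : {set {set V}}) : F \subset E1 :\ e ->
    matchpoly (F :|: E2) = matchpoly F * matchpoly E2.
  move=> sF; apply: IH => [|e' f e'F fE2].
    by apply: leq_ltn_trans (subset_leq_card sF) _; move: cE; rewrite (cardsD1 e) eE.
  by apply: dj => //; have := subsetP sF _ e'F; rewrite !inE => /andP[].
have eE2 : e \notin E2.
  by apply/negP => eE2; have := dj _ _ eE eE2; rewrite eqxx.
rewrite -(setD1K eE) -setUA !matchpolyU1 ?setD11 //; last first.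
  by rewrite in_setU setD11 (negPf eE2).
rewrite djS // mulrDl -mulrA; congr (_ + 'X * _).
rewrite -djS; last by apply/subsetP => f; rewrite inE => /andP[].
congr matchpoly; apply/setP => f; rewrite !inE.
have [fE2|] := boolP (f \in E2); last by rewrite !orbF.
by rewrite !orbT; case/andP: (dj _ _ eE fE2).
Qed.

Lemma matchpoly_gt0 E : 0 < (matchpoly E).[1].
Proof.
rewrite /matchpoly horner_sum (bigD1 set0) /=; last first.
  by rewrite sub0set; apply/trivIsetP => A B; rewrite inE.
rewrite !hornerE cards0 expr0 ltr_pwDl //; apply: sumr_ge0 => M _.
by rewrite !hornerE expr1n.
Qed.

End MatchingPolynomial.

Lemma av_matchpoly (R : realFieldType) (G : sgraph) :
  av R G = (matchpoly R (edges G))^`().[1] / (matchpoly R (edges G)).[1].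
Proof.
(* The weights [id] and 1 give the numerator and the denominator of [av]. *)
have sumE (w : nat -> nat) : (\sum_(0 <= k < #|edges G|.+1) (w k * num_matchings G k)%:R : R) =
    \sum_(M : {set {set G}} | (M \subset edges G) && trivIset M) (w #|M|)%:R.
  rewrite big_mkord.
  rewrite (partition_big (fun M : {set {set G}} => inord #|M| : 'I_#|edges G|.+1) predT) //=.
  apply: eq_bigr => k _; rewrite natrM mulr_natr -sumr_const.
  have ME (M : {set {set G}}) : M \subset edges G -> (inord #|M| == k) = (#|M| == k).
    by move=> sM; rewrite -val_eqE /= inordK // ltnS subset_leq_card.
  apply: eq_big => [M|M].
    by rewrite inE /matching; case: (boolP (M \subset _)) => // /ME ->.
  by rewrite inE => /andP[_ /eqP->].
rewrite /av (sumE id) /=; congr (_ / _).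
  rewrite /matchpoly raddf_sum horner_sum; apply: eq_bigr => M _ /=.
  by rewrite derivXn hornerMn hornerXn expr1n.
under eq_bigr do rewrite -[num_matchings _ _]mul1n.
rewrite (sumE (fun=> 1%N)) /matchpoly horner_sum; apply: eq_bigr => M _.
by rewrite !hornerE expr1n.
Qed.

(** * Trees as graphs *)

Section SpanningTrees.
Variable G : sgraph.
Implicit Types (u v w x y : G) (S : {set G}).

(* [spans v S t]: the subgraph induced on [S] is the tree [t] with root [v]. *)
Inductive spans : G -> {set G} -> rtree -> Prop :=
| SpansLeaf v : spans v [set v] Leaf
| SpansJoin v u S1 S2 t1 t2 : spans v S1 t1 -> spans u S2 t2 ->
    [disjoint S1 & S2] ->
    {in S1 & S2, forall x y, adj x y = (x == v) && (y == u)} ->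
    spans v (S1 :|: S2) (Join t1 t2).

Lemma spans_root v S t : spans v S t -> v \in S.
Proof.
elim=> [w|{}v u S1 S2 t1 t2 _ v1 _ _ _ _]; first exact: set11.
by rewrite inE v1.
Qed.

Lemma spans_card v S t : spans v S t -> #|S| = nverts t.
Proof.
elim=> [w|{}v u S1 S2 t1 t2 _ c1 _ c2 dj _] /=; first exact: cards1.
by rewrite -c1 -c2; apply/eqP; rewrite (leq_card_setU S1 S2).2.
Qed.

Definition edges_in S : {set {set G}} := [set e in edges G | e \subset S].

Lemma edgesP (e : {set G}) :
  reflect (exists x y, adj x y /\ e = [set x; y]) (e \in edges G).
Proof.
apply: (iffP imset2P) => [[x y _] | [x [y [xy ->]]]].
  by rewrite inE => /andP[_ xy] ->; exists x, y.
by exists x y; rewrite ?inE.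
Qed.

Lemma edges_inT : edges_in [set: G] = edges G.
Proof. by apply/setP => e; rewrite inE subsetT andbT. Qed.

Lemma edges_in1 v : edges_in [set v] = set0.
Proof.
apply/setP => e; rewrite !inE; apply/negP => /andP[/edgesP[x [y [xy ->]]]].
by rewrite subUset !sub1set !inE => /andP[/eqP xv /eqP yv]; rewrite xv yv adj_irr in xy.
Qed.

Lemma edges_in0 : edges_in set0 = set0.
Proof.
apply/setP => e; rewrite !inE; apply/negP => /andP[/edgesP[x [y [xy ->]]]].
by rewrite subUset !sub1set inE.
Qed.

Lemma edges_in_disjoint S1 S2 (e f : {set G}) : [disjoint S1 & S2] ->
  e \in edges_in S1 -> f \in edges_in S2 -> (e != f) && [disjoint e & f].
Proof.
move=> dj; rewrite !inE => /andP[/edgesP[x [y [_ ->]]] e1] /andP[_ f2].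
have ef := disjointWl e1 (disjointWr f2 dj); rewrite ef andbT.
apply: contraTneq ef => <-; apply/negP => /disjointFr/(_ (set21 x y)).
by rewrite set21.
Qed.

Lemma edges_inU S1 S2 : {in S1 & S2, forall x y, ~~ adj x y} ->
  edges_in (S1 :|: S2) = edges_in S1 :|: edges_in S2.
Proof.
move=> nadj; apply/setP => e; rewrite !inE -andb_orr.
have [/edgesP[x [y [xy ->]]] /=|//] := boolP (e \in edges G).
rewrite !subUset !sub1set !inE.
have [x1|x1] := boolP (x \in S1); have [x2|x2] := boolP (x \in S2);
  have [y1|y1] := boolP (y \in S1); have [y2|y2] := boolP (y \in S2) => //=.
- by have := nadj _ _ x1 y2; rewrite xy.
- by have := nadj _ _ y1 x2; rewrite adj_sym xy.
Qed.

Lemma edges_in_Join v u S1 S2 : v \in S1 -> u \in S2 ->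
  {in S1 & S2, forall x y, adj x y = (x == v) && (y == u)} ->
  edges_in (S1 :|: S2) = [set v; u] |: (edges_in S1 :|: edges_in S2).
Proof.
move=> v1 u2 adjE; apply/setP => e; rewrite !inE.
have vu : adj v u by rewrite adjE // !eqxx.
have [->|ne /=] := eqVneq e [set v; u].
  have -> : [set v; u] \in edges G by apply/edgesP; exists v, u.
  by rewrite subUset !sub1set !inE v1 u2 orbT.
rewrite -andb_orr.
have [/edgesP[x [y [xy eE]]] /=|//] := boolP (e \in edges G).
rewrite eE !subUset !sub1set !inE.
have [x1|x1] := boolP (x \in S1); have [x2|x2] := boolP (x \in S2);
  have [y1|y1] := boolP (y \in S1); have [y2|y2] := boolP (y \in S2) => //=.
- by move: xy ne; rewrite eE adjE // => /andP[/eqP-> /eqP->]; rewrite eqxx.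
- move: xy ne; rewrite eE adj_sym adjE // => /andP[/eqP-> /eqP->].
  by rewrite setUC eqxx.
Qed.

Lemma setUD1l v S1 S2 : v \notin S2 -> (S1 :|: S2) :\ v = (S1 :\ v) :|: S2.
Proof.
move=> v2; apply/setP => x; rewrite !inE.
by have [->|] := eqVneq x v; rewrite ?(negPf v2).
Qed.

(** * The parameters of a rooted tree in terms of matching polynomials *)

Section Weights.
Variable R : realFieldType.

Local Notation Z S := (matchpoly R (edges_in S)).

Lemma matchpoly_Join v u S1 S2 : v \in S1 -> u \in S2 -> [disjoint S1 & S2] ->
  {in S1 & S2, forall x y, adj x y = (x == v) && (y == u)} ->
  Z (S1 :|: S2) = Z S1 * Z S2 + 'X * (Z (S1 :\ v) * Z (S2 :\ u)).
Proof.
move=> v1 u2 dj adjE; rewrite (edges_in_Join v1 u2 adjE).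
have u1 : u \notin S1 by rewrite (disjointFl dj).
have v2 : v \notin S2 by rewrite (disjointFr dj).
rewrite matchpolyU1; last first.
  by rewrite !inE !subUset !sub1set (negPf u1) (negPf v2) !andbF.
rewrite matchpolyU => [|e f]; last exact: edges_in_disjoint.
rewrite -[Z (S1 :\ v) * _]matchpolyU => [|e f]; last first.
  apply: edges_in_disjoint; apply: disjointWl (subD1set _ _) _.
  exact: disjointWr (subD1set _ _) dj.
congr (_ + 'X * matchpoly R _); apply/setP => e; rewrite !inE !subsetD1 -!andb_orr -andbA.
congr (_ && _); rewrite disjoints_subset subUset !sub1set !inE.
have c1 : e \subset S1 -> u \notin e by move=> /subsetP/(_ u) h; exact: contra h u1.
have c2 : e \subset S2 -> v \notin e by move=> /subsetP/(_ v) h; exact: contra h v2.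
move: c1 c2; case: (e \subset S1); case: (e \subset S2) => //=.
- by move=> -> // -> //.
- by move=> -> // _; rewrite andbT orbF.
- by move=> _ -> //.
Qed.

Lemma matchpoly_Join_root v u S1 S2 : v \in S1 -> u \in S2 -> [disjoint S1 & S2] ->
  {in S1 & S2, forall x y, adj x y = (x == v) && (y == u)} ->
  Z ((S1 :|: S2) :\ v) = Z (S1 :\ v) * Z S2.
Proof.
move=> v1 u2 dj adjE; rewrite setUD1l; last by rewrite (disjointFr dj).
rewrite edges_inU => [|x y]; last first.
  by rewrite !inE => /andP[xv x1] y2; rewrite adjE // (negPf xv).
rewrite matchpolyU // => e f; apply: edges_in_disjoint.
exact: disjointWl (subD1set _ _) dj.
Qed.

(** Joining gives [p = p1 * p2 + X * q1 * q2] and [q = q1 * p2]. The recursions for [tau], [mean]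
    and [eps] are these identities and their logarithmic derivatives at 1. *)
Lemma spans_weights v S t : spans v S t ->
  [/\ tau R t = (Z (S :\ v)).[1] / (Z S).[1],
      mean R t = (Z S)^`().[1] / (Z S).[1] &
      eps R t = 1 + (Z (S :\ v))^`().[1] / (Z (S :\ v)).[1] -
                (Z S)^`().[1] / (Z S).[1]].
Proof.
elim=> [w|{}v u S1 S2 t1 t2 sp1 [T1 M1 E1] sp2 [T2 M2 E2] dj adjE].
  have -> : [set w] :\ w = set0 by rewrite setDv.
  rewrite edges_in0 edges_in1 matchpoly0 -polyC1 derivC !hornerC.
  by split=> /=; rewrite ?mul0r ?divr1 ?addr0 ?subr0.
have [v1 u2] := (spans_root sp1, spans_root sp2).
rewrite (matchpoly_Join v1 u2 dj adjE) (matchpoly_Join_root v1 u2 dj adjE) /=.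
rewrite T1 T2 M1 M2 E1 E2 /edge_gain.
rewrite !(derivD, derivM, derivX) !(hornerD, hornerM, hornerX, hornerC).
have := matchpoly_gt0 R (edges_in S1); have := matchpoly_gt0 R (edges_in S2).
have := matchpoly_gt0 R (edges_in (S1 :\ v)); have := matchpoly_gt0 R (edges_in (S2 :\ u)).
move: (Z S1).[1] (Z S2).[1] (Z (S1 :\ v)).[1] (Z (S2 :\ u)).[1] => p1 p2 q1 q2.
move: (Z S1)^`().[1] (Z S2)^`().[1] (Z (S1 :\ v))^`().[1] (Z (S2 :\ u))^`().[1].
move=> p1' p2' q1' q2' q20 q10 p20 p10.
have pp : 0 < p1 * p2 + q1 * q2 by rewrite addr_gt0 ?mulr_gt0.
by split; field; rewrite ?gt_eqF.
Qed.

End Weights.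

(** * Growing a rooted tree inside a graph *)

Lemma disjoint_setU1 w S1 S2 :
  [disjoint w |: S1 & S2] = (w \notin S2) && [disjoint S1 & S2].
Proof. by rewrite !disjoints_subset subUset sub1set inE. Qed.

(** The leaf goes into the part that contains [p]; the other part has no neighbour of [w]. *)
Lemma spans_add_leaf v S t p w : spans v S t -> p \in S -> w \notin S ->
  {in S, forall x, adj x w = (x == p)} -> exists t', spans v (w |: S) t'.
Proof.
move=> sp; elim: sp p => [{}v|{}v u S1 S2 t1 t2 sp1 IH1 sp2 IH2 dj adjE] p.
  rewrite inE => /eqP-> wv adjw; exists (Join Leaf Leaf); rewrite setUC.
  apply: SpansJoin; try exact: SpansLeaf.
    by rewrite disjoints1 inE eq_sym -in_set1.
  move=> x y; rewrite !inE => /eqP-> /eqP->.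
  by rewrite adjw ?set11 // !eqxx.
rewrite !inE negb_or => pS /andP[w1 w2] adjw.
have adjw1 : {in S1, forall x, adj x w = (x == p)} by move=> x x1; rewrite adjw // inE x1.
have adjw2 : {in S2, forall x, adj x w = (x == p)} by move=> x x2; rewrite adjw // inE x2 orbT.
have [p1|p1] := boolP (p \in S1).
  have p2 : p \notin S2 by rewrite (disjointFr dj).
  have [t' sp'] := IH1 p p1 w1 adjw1; exists (Join t' t2).
  rewrite setUA; apply: (SpansJoin sp' sp2); first by rewrite disjoint_setU1 w2.
  move=> x y; rewrite !inE => /orP[/eqP->|x1] y2; last exact: adjE.
  rewrite adj_sym adjw2 //; have [yp|_] := eqVneq y p; first by rewrite -yp y2 in p2.
  by have [wv|//] := eqVneq w v; have := spans_root sp1; rewrite -wv (negPf w1).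
have {pS} p2 : p \in S2 by move: pS; rewrite (negPf p1).
have [t' sp'] := IH2 p p2 w2 adjw2; exists (Join t1 t').
rewrite setUCA; apply: (SpansJoin sp1 sp').
  by rewrite disjoint_sym disjoint_setU1 w1 disjoint_sym.
move=> x y x1; rewrite !inE => /orP[/eqP->|y2]; last exact: adjE.
rewrite adjw1 //; have [xp|_] := eqVneq x p; first by rewrite -xp x1 in p1.
have [wu|_] := eqVneq w u; last by rewrite andbF.
by have := spans_root sp2; rewrite -wu (negPf w2).
Qed.

(** The walks stay inside [S], so that they can be closed up through a vertex outside. *)
Lemma spans_connect v S t : spans v S t ->
  {in S &, forall x y, connect [rel x y | [&& adj x y, x \in S & y \in S]] x y}.
Proof.
set e := fun S : {set G} => [rel x y | [&& adj x y, x \in S & y \in S]].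
suff con : spans v S t -> {in S, forall x, connect (e S) v x}.
  move=> /con c x y /c vx /c; apply: connect_trans; rewrite sym_connect_sym //.
  by move=> a b /=; rewrite adj_sym [(a \in S) && _]andbC.
have mono (S1 S2 : {set G}) x y : S1 \subset S2 -> connect (e S1) x y -> connect (e S2) x y.
  move=> s12; apply: connect_sub => a b /and3P[ab aS bS]; apply: connect1.
  by rewrite /= ab !(subsetP s12).
elim=> [{}v|{}v u S1 S2 t1 t2 sp1 IH1 sp2 IH2 dj adjE] x; first by rewrite inE => /eqP->.
have [v1 u2] := (spans_root sp1, spans_root sp2).
rewrite inE => /orP[/IH1|/IH2 ux]; first exact/mono/subsetUl.
apply: connect_trans (mono _ _ _ _ (subsetUr S1 S2) ux); apply: connect1.
by rewrite /= adjE // !eqxx !inE v1 u2 orbT.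
Qed.

(** Otherwise a simple path in [S] from [p] to [p'] closes through [w] to a cycle of length at least
    3. *)
Lemma spans_nbr_uniq v S t w p p' : acyclic G -> spans v S t -> w \notin S ->
  p \in S -> p' \in S -> adj p w -> adj p' w -> p' = p.
Proof.
move=> acy sp wS pS pS' pw pw'; apply/eqP; apply/negPn/negP => ne.
have /connectP[s0 path0 last0] := spans_connect sp pS pS'.
have [s [pths us subs lasts]] : exists s,
    [/\ path (@adj G) p s, uniq (p :: s), {subset s <= S} & p' = last p s].
  move: last0; case: (shortenP path0) => s pths us _ ->; exists s; split=> //.
    by apply: sub_path pths => a b /and3P[].
  elim: s p pths {us pS pw ne path0} => //= y s IH q /andP[/and3P[_ _ yS] pths] z.
  by rewrite inE => /orP[/eqP->|]; last exact: IH pths z.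
have /acy : ucycle (@adj G) [:: w, p & s].
  apply/andP; split.
    by rewrite /= rcons_path pths -lasts pw' adj_sym pw.
  rewrite /= -/(uniq (p :: s)) us andbT inE negb_or.
  apply/andP; split; first by apply: contraNneq wS => ->.
  by apply: contraNN wS; exact: subs.
by case: s lasts {pths us subs} => [|? ?] //= lasts; rewrite lasts eqxx in ne.
Qed.

(** A walk leaving [S] provides [w] and [p]; acyclicity makes [p] the only neighbour of [w] in
    [S]. *)
Lemma spans_step v S t : connected G -> acyclic G -> spans v S t -> S != setT ->
  exists w p t', [/\ w \notin S, p \in S, {in S, forall x, adj x w = (x == p)} &
    spans v (w |: S) t'].
Proof.
move=> [_ con] acy sp ne; have vS := spans_root sp.
have [w [p [wS pS pw]]] : exists w p, [/\ w \notin S, p \in S & adj p w].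
  have [z zS] : exists z, z \notin S.
    apply/existsP; apply: contraNT ne => /existsPn h.
    by apply/eqP/setP => z; rewrite inE (negPn (h z)).
  have /connectP[s + lasts] := con v z.
  elim: s v vS {sp} lasts => [|y s IH] x xS /=; first by move=> zx; rewrite zx xS in zS.
  move=> lasts /andP[xy pths]; have [yS|yS] := boolP (y \in S); first exact: IH lasts pths.
  by exists y, x.
have adjw : {in S, forall x, adj x w = (x == p)}.
  move=> x xS; apply/idP/eqP => [xw|->//].
  exact: spans_nbr_uniq acy sp wS pS xS pw xw.
have [t' sp'] := spans_add_leaf sp pS wS adjw.
by exists w, p, t'.
Qed.

Lemma spans_grow v n : connected G -> acyclic G -> (0 < n <= #|G|)%N ->
  exists S t, spans v S t /\ #|S| = n.
Proof.
move=> con acy; elim: n => // -[|n] IH /andP[_ nG].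
  by exists [set v], Leaf; split; [exact: SpansLeaf | exact: cards1].
have [S [t [sp cS]]] := IH (ltnW nG).
have [|w [p [t' [wS _ _ sp']]]] := spans_step con acy sp.
  by apply: contraTneq nG => ST; rewrite -ltnNge -cS ST cardsT.
by exists (w |: S), t'; rewrite cardsU1 wS cS.
Qed.

Lemma spans_setT v : tree G -> exists t, spans v setT t.
Proof.
move=> [con acy]; have [|S [t [sp cS]]] := spans_grow v (n := #|G|) con acy.
  by rewrite con.1 leqnn.
suff <- : S = setT by exists t.
by apply/eqP; rewrite eqEcard subsetT cardsT cS leqnn.
Qed.

(** Once all vertices but one are spanned, the last one has a single neighbour. *)
Lemma tree_leaf : tree G -> (1 < #|G|)%N ->
  exists w p : G, forall x, adj x w = (x == p).
Proof.
move=> [con acy] G1; have [v _] : exists v, v \in G by apply/card_gt0P; exact: con.1.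
have [|S [t [sp cS]]] := spans_grow v (n := #|G|.-1) con acy.
  by rewrite -ltnS prednK ?G1 ?leq_pred // con.1.
have [|w [p [t' [wS pS adjw sp']]]] := spans_step con acy sp.
  by apply/eqP => ST; move: cS G1; rewrite ST cardsT; lia.
have STw : w |: S = setT.
  by apply/eqP; rewrite eqEcard subsetT cardsT cardsU1 wS cS add1n prednK ?leqnn ?con.1.
exists w, p => x; have : x \in w |: S by rewrite STw inE.
rewrite in_setU1 => /orP[/eqP->|]; last exact: adjw.
by rewrite adj_irr; apply/esym/negbTE; apply: contraNneq wS => ->.
Qed.

(** * Leaves and paths as rooted trees *)

Lemma spans_Join_nbr v S t1 t2 : spans v S (Join t1 t2) ->
  exists S1 S2 u, [/\ S = S1 :|: S2, spans v S1 t1, u \in S2, [disjoint S1 & S2] & adj v u].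
Proof.
move E : (Join t1 t2) => t sp; case: sp E => // {}v u S1 S2 t1' t2' sp1 sp2 dj adjE [-> _].
exists S1, S2, u; split=> //; first exact: spans_root sp2.
by rewrite adjE ?eqxx //; [exact: spans_root sp1 | exact: spans_root sp2].
Qed.

(** At a leaf as root there is only one branch, since two branches would give the root two
    neighbours. *)
Lemma tree_spans_leaf : tree G -> (1 < #|G|)%N ->
  exists v t, spans v setT (Join Leaf t).
Proof.
move=> trG G1; have [w [p adjw]] := tree_leaf trG G1.
have [t sp] := spans_setT w trG; exists w.
case: t sp => [|t1 t2] sp.
  by move: G1; rewrite -cardsT (spans_card sp).
case: t1 sp => [|t11 t12] sp; first by exists t2.
have [S1 [S2 [u [_ sp1 u2 dj]]]] := spans_Join_nbr sp.
have [S11 [S12 [u' [S1E _ u12 _]]]] := spans_Join_nbr sp1.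
rewrite ![adj w _]adj_sym !adjw => /eqP u'p /eqP up.
by have := disjointFl dj u2; rewrite up -u'p S1E inE u12 orbT.
Qed.

(** The list runs from the root to the other end; the bounds on [i] and [j] keep the default of
    [nth] out of play. *)
Lemma spans_end_path v S t : spans v S t -> end_path t ->
  exists s, [/\ uniq (v :: s), v :: s =i S &
    forall i j, (i <= size s)%N -> (j <= size s)%N ->
      adj (nth v (v :: s) i) (nth v (v :: s) j) = (i.+1 == j) || (j.+1 == i)].
Proof.
elim=> [{}v|{}v u S1 S2 t1 t2 sp1 _ sp2 IH dj adjE].
  move=> _; exists [::]; split=> //; first by move=> x; rewrite !inE.
  by move=> [|i] [|j] //= _ _; rewrite adj_irr.
move=> ep; have {ep} [t1L ep2] : t1 = Leaf /\ end_path t2 by case: t1 sp1 ep => //.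
have {sp1 t1L} S1E : S1 = [set v].
  by move: sp1; rewrite t1L; move EL : Leaf => l sp; case: sp EL.
have [s [us sS adjs]] := IH ep2; exists (u :: s).
have S1v : v \in S1 by rewrite S1E set11.
have vS2 : v \notin S2 by rewrite (disjointFr dj).
split.
- by rewrite cons_uniq us andbT sS.
- by move=> x; rewrite S1E in_setU -sS !inE.
have memn i : (i <= size s)%N -> nth v (u :: s) i \in S2 by move=> ?; rewrite -sS mem_nth.
have nu i : (i <= size s)%N -> (nth v (u :: s) i == u) = (i == 0)%N.
  by move=> ?; rewrite -[X in _ == X]/(nth v (u :: s) 0) nth_uniq.
have def i : (i <= size s)%N -> nth v (u :: s) i = nth u (u :: s) i.
  by move=> ?; apply: set_nth_default.
case=> [|i] [|j] /= hi hj.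
- by rewrite adj_irr.
- by rewrite adjE ?memn // eqxx /= nu // orbF eqSS eq_sym.
- by rewrite adj_sym adjE ?memn // eqxx /= nu // eqSS eq_sym.
- by rewrite !def // adjs // !eqSS.
Qed.

Lemma spans_is_path v t : spans v setT t -> end_path t -> is_path G.
Proof.
move=> sp /(spans_end_path sp)[s [us sS adjs]].
have [l [ul lG adjl]] : exists l, [/\ uniq l, forall x : G, x \in l &
    forall i j, (i < size l)%N -> (j < size l)%N ->
      adj (nth v l i) (nth v l j) = (i.+1 == j) || (j.+1 == i)].
  by exists (v :: s); split=> // x; rewrite sS inE.
have idx x : (index x l < size l)%N by rewrite index_mem.
exists (size l), (fun x => Ordinal (idx x)); split.
  exists (fun i : 'I_(size l) => nth v l i) => [x|i]; first by rewrite /= nth_index.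
  by apply/val_inj; rewrite /= index_uniq.
by move=> x y; rewrite {1}/adj /= /path_adj /= -adjl // !nth_index.
Qed.

Lemma path_spans n (f : G -> 'I_n) : bijective f ->
  (forall x y, adj x y = path_adj (f x) (f y)) -> (0 < n)%N ->
  exists v, spans v setT (iter n.-1 (Join Leaf) Leaf).
Proof.
move=> [g fK gK] adjf n0.
(* The path is built from its far end: the last [k + 1] vertices are spanned from the one numbered
   [n - 1 - k]. *)
have main k : (k < n)%N -> exists2 v, f v = (n.-1 - k)%N :> nat &
    spans v [set x | n.-1 - k <= f x]%N (iter k (Join Leaf) Leaf).
  elim: k => [|k IH] kn.
    have h : (n.-1 < n)%N by rewrite prednK.
    exists (g (Ordinal h)); rewrite ?gK ?subn0 //=.
    suff -> : [set x | n.-1 <= f x]%N = [set g (Ordinal h)] by exact: SpansLeaf.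
    apply/setP => x; rewrite !inE -(can_eq fK) gK -val_eqE /=.
    by have := ltn_ord (f x); lia.
  have [u fu sp] := IH (ltnW kn).
  have h : (n.-1 - k.+1 < n)%N by lia.
  exists (g (Ordinal h)); rewrite ?gK //=; set v := g _.
  have fv : f v = (n.-1 - k.+1)%N :> nat by rewrite /v gK.
  have -> : [set x | n.-1 - k.+1 <= f x]%N = [set v] :|: [set x | n.-1 - k <= f x]%N.
    apply/setP => x; rewrite !inE -(can_eq fK) -val_eqE /= fv; lia.
  apply: (SpansJoin (SpansLeaf v) sp); first by rewrite disjoints1 inE fv; lia.
  move=> x y; rewrite !inE => /eqP-> hy; rewrite eqxx /= adjf /path_adj fv.
  by rewrite -(can_eq fK) -val_eqE /= fu; lia.
have [|v _ sp] := main n.-1; first by rewrite prednK.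
exists v; suff <- : [set x | n.-1 - n.-1 <= f x]%N = setT by [].
by apply/setP => x; rewrite !inE subnn.
Qed.

Lemma av_spans (R : realFieldType) v t : spans v setT t -> av R G = mean R t.
Proof.
by move=> /(spans_weights R)[_ -> _]; rewrite edges_inT av_matchpoly.
Qed.

End SpanningTrees.

(** * Path graphs and the extremal inequality *)

Lemma path_graph_tree n : (0 < n)%N -> tree_of_order n (path_graph n).
Proof.
move=> n0; split; last exact: card_ord.
split.
  split=> [|x y]; first by rewrite card_ord.
  have con k (i j : path_graph n) : (i + k = j)%N -> connect (@adj (path_graph n)) i j.
    elim: k j => [|k IH] j ij.
      by have -> : i = j; [apply: ord_inj; rewrite -ij addn0 | exact: connect0].
    have h : (i + k < n)%N by have := ltn_ord j; lia.
    apply: connect_trans (IH (Ordinal h) erefl) (connect1 _).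
    by rewrite /adj /= /path_adj /= -addnS ij eqxx.
  have [xy|yx] := leqP x y; first by apply: (con (y - x)%N); rewrite subnKC.
  rewrite sym_connect_sym; last exact: adj_sym.
  by apply: (con (x - y)%N); rewrite subnKC // ltnW.
(* On a cycle of length at least 3, the vertex with the largest number would have two distinct
   neighbours, both numbered one less. *)
move=> c /andP[cyc uc]; rewrite ltnNge; apply/negP => sz.
have [x0 x0c] : exists x0, x0 \in c by case: c sz {cyc uc} => // x0 ? _; exists x0; exact: mem_head.
have [x xc xmax] := arg_maxnP (fun i : 'I_n => i : nat) x0c.
have [i c' rc] := rot_to xc.
have : cycle (@adj (path_graph n)) (x :: c') by rewrite -rc rot_cycle.
have : uniq (x :: c') by rewrite -rc rot_uniq.
have : (3 <= size (x :: c'))%N by rewrite -rc size_rot.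
have xm y : y \in c' -> (y <= x)%N.
  move=> yc'; have yc : y \in c by rewrite -(mem_rot i) rc inE yc' orbT.
  exact: xmax.
case: c' {rc} xm => [|y c'] // xm sz' /and3P[_ yc' _].
rewrite /= rcons_path => /and3P[xy _ zx].
have zc : last y c' \in c' by case: c' sz' {xm yc' zx} => //= z c' _; exact: mem_last.
have yx := xm y (mem_head _ _); have zx' : (last y c' <= x)%N by apply: xm; rewrite inE zc orbT.
have : last y c' = y.
  by apply: ord_inj; move: xy zx yx zx'; rewrite /adj /= /path_adj /=; lia.
by move=> E; rewrite -E zc in yc'.
Qed.

Theorem theorem4p3 (R : rcfType) :
  let a : R := (5 - Num.sqrt 5) / 10 in
  let b : R := (7 * Num.sqrt 5 - 17) / 10 in
  (forall (n : nat) (T : sgraph),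
      tree_of_order n T -> ~ is_path T -> av R T <= a * n%:R + b) /\
  (forall n : nat, (0 < n)%N ->
      tree_of_order n (path_graph n) /\
      forall T : sgraph, tree_of_order n T -> av R T <= av R (path_graph n)).
Proof.
move=> a b.
pose phi : R := (Num.sqrt 5 - 1) / 2.
have r2 : Num.sqrt 5 ^+ 2 = 5 :> R by rewrite sqr_sqrtr.
have r0 : 0 <= Num.sqrt 5 :> R by exact: sqrtr_ge0.
have phi2 : phi ^+ 2 = 1 - phi by rewrite /phi; field: r2.
have phi0 : 0 < phi by rewrite /phi; nra.
have aE : a = (2 - phi) / 5 by rewrite /a /phi; field.
have bE : b = - (1 - 7 * phi / 5) by rewrite /b /phi; field.
(* The order is recorded to exceed 3 because [long_path_defect] starts at four vertices. *)
have dichotomy (T : sgraph) : tree T ->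
    (exists v t, spans v [set: T] t /\ end_path t) \/
    (3 < #|T|)%N /\ av R T <= a * #|T|%:R + b.
  move=> trT; have [v _] : exists v, v \in T by apply/card_gt0P; exact: trT.1.1.
  have [T1|T1] := leqP #|T| 1.
    have [t sp] := spans_setT v trT; left; exists v, t; split=> //.
    move: T1; rewrite -cardsT (spans_card sp); apply: contraTT => /nonpath_nverts; lia.
  have {v} [v [t sp]] := tree_spans_leaf trT T1.
  have [tp|tp] := boolP (end_path t); first by left; exists v, (Join Leaf t).
  have cT : #|T| = (nverts t).+1 by rewrite -cardsT (spans_card sp).
  right; split; first by rewrite cT ltnS nonpath_nverts.
  (* The leaf chosen as root serves as the branch [u] of [defect_lb], once the arguments of [Join]
     are exchanged. *)
  have := defect_lb phi0 phi2 tp Leaf; rewrite defect_JoinC /defect -(av_spans R sp).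
  by rewrite aE bE cT /= add1n; lra.
split=> [n T [trT <-] np|n n0].
  case: (dichotomy T trT) => [[v [t [sp tp]]]|[_ //]].
  by case: np; exact: spans_is_path sp tp.
split=> [|T [trT cT]]; first exact: path_graph_tree.
have [v spP] : exists v, spans v [set: path_graph n] (iter n.-1 (Join Leaf) Leaf).
  by apply: (@path_spans (path_graph n) n id) => //; exists id.
rewrite (av_spans R spP).
case: (dichotomy T trT) => [[w [t [sp /end_path_iter[m tE]]]]|].
  rewrite tE in sp; rewrite (av_spans R sp); suff -> : n.-1 = m by [].
  by rewrite -cT -cardsT (spans_card sp) nverts_iter.
rewrite cT => -[n4 avT]; apply: le_trans avT _.
case: n n4 {n0 cT v spP} => [|[|[|[|n]]]] // _.
by have := long_path_defect phi0 phi2 n; rewrite /defect nverts_iter aE bE; lra.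
Qed.
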